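(* Let $\mathbb{F}=\mathbb{R}$. For each of the following 14 sets $J=\{j_1<j_2<j_3<j_4\}$ of pivot columns (numbered by their position in the lexicographic ordering of the 35 four-element subsets of $\{1,\dots,8\}$ containing $1$), let $[R]$ be a $4\times 8$ matrix in row canonical form with leading 1s exactly in the columns of $J$, let $R$ be its row space, and let $P$ be its $4\times 4$ parameter matrix: Case 1: $\{1,2,3,4\}$; Case 2: $\{1,2,3,5\}$; Case 3: $\{1,2,3,6\}$; Case 4: $\{1,2,3,7\}$; Case 6: $\{1,2,4,5\}$; Case 7: $\{1,2,4,6\}$; Case 8: $\{1,2,4,7\}$; Case 10: $\{1,2,5,6\}$; Case 11: $\{1,2,5,7\}$; Case 16: $\{1,3,4,5\}$; Case 17: $\{1,3,4,6\}$; Case 18: $\{1,3,4,7\}$; Case 20: $\{1,3,5,6\}$; Case 21: $\{1,3,5,7\}$. Then the operad $\mathcal{O}/(R)$ is self-dual if and only if $P^tDP=E$, where the diagonal matrices $D,E$ are: - Case 1: $D=E=I_4$; - Cases 2, 3, 4, 6, 7, 8, 16, 17, 18: $D=\mathrm{diag}(1,1,1,-1)$, $E=\mathrm{diag}(-1,1,1,1)$; - Cases 10, 11, 20, 21: $D=\mathrm{diag}(1,1,-1,-1)$, $E=\mathrm{diag}(-1,-1,1,1)$. Consequently, every such $P$ has the form $P=\overline{\sqrt{D}}\,C\,\sqrt{E}$, where $C$ is an orthogonal matrix ($C^tC=I_4$, entries in $\mathbb{C}$) which has zeros in the same entries in which $P$ is required to be zero.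
   Context: $\mathcal{O}$ is the free nonsymmetric operad over $\mathbb{F}$ generated by two binary operations $\vdash,\dashv$ (no symmetry or associativity assumed), graded by weight $w$ (number of operations). Its weight-2 component $\mathcal{O}(2)$ has dimension 8 with ordered basis $(-\vdash-)\vdash-$, $(-\vdash-)\dashv-$, $(-\dashv-)\vdash-$, $(-\dashv-)\dashv-$, $-\vdash(-\vdash-)$, $-\vdash(-\dashv-)$, $-\dashv(-\vdash-)$, $-\dashv(-\dashv-)$. Identify $\mathcal{O}(2)$ with $\mathbb{F}^8$ using this basis. Let $\langle-,-\rangle$ be the symmetric bilinear form on $\mathcal{O}(2)$ for which this basis is orthogonal, the first four basis elements have $\langle m,m\rangle=1$, and the last four have $\langle m,m\rangle=-1$. For a subspace $R\subseteq\mathcal{O}(2)$, $R^\pm$ denotes its orthogonal complement with respect to $\langle-,-\rangle$, and $(R)$ the operad ideal generated by $R$. The Koszul dual of $\mathcal{Q}=\mathcal{O}/(R)$ is $\mathcal{Q}^!=\mathcal{O}/(R^\pm)$, and $\mathcal{Q}$ is self-dual if $\mathcal{Q}=\mathcal{Q}^!$, equivalently $R=R^\pm$. Row canonical form (RCF) means reduced row echelon form. For a $4\times 8$ matrix $[R]$ of rank 4 in RCF with leading 1s in columns $j_1<\dots<j_4$, the parameter matrix $P$ is the $4\times 4$ matrix obtained by deleting columns $j_1,\dots,j_4$ from $[R]$. Entries of $P$ coming from positions to the left of the leading 1 of their row are required to be zero; all other entries are free parameters in $\mathbb{F}$. For a diagonal matrix $D$ with diagonal entries $\pm1$, $\sqrt{D}$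 is a diagonal matrix over $\mathbb{C}$ whose square is $D$ (diagonal entries $1$ where $D$ has $1$ and a square root $\pm i$ of $-1$ where $D$ has $-1$); the bar is complex conjugation, so $\overline{\sqrt{D}}=(\sqrt{D})^{-1}$. *)

(* Defs.v *)
From HB Require Import structures.
From mathcomp Require Import all_boot all_order all_algebra.
From mathcomp Require Import boolp classical_sets reals.
From mathcomp Require Import complex.
Set Implicit Arguments.
Unset Strict Implicit.
Unset Printing Implicit Defensive.
Import Order.TTheory GRing.Theory Num.Theory.
Local Open Scope classical_set_scope.
Local Open Scope ring_scope.

(** Monomials of the free nonsymmetric operad on two binary operations: planar
    binary trees whose internal nodes are labelled by an operation.  A tree with
    [w] internal nodes has weight [w] and arity [w + 1]. *)
Inductive binop := Vdash | Dashv.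

Inductive tree := Leaf | Node of binop & tree & tree.

Fixpoint weight (t : tree) : nat :=
  if t is Node _ l r then (weight l + weight r).+1 else 0.

Definition binop_to_bool (o : binop) : bool := if o is Vdash then true else false.
Definition bool_to_binop (b : bool) : binop := if b then Vdash else Dashv.
Lemma binop_to_boolK : cancel binop_to_bool bool_to_binop.
Proof. by case. Qed.
HB.instance Definition _ := Countable.copy binop (can_type binop_to_boolK).

Fixpoint tree_encode (t : tree) : GenTree.tree binop :=
  if t is Node o l r then
    GenTree.Node 0 [:: GenTree.Leaf o; tree_encode l; tree_encode r]
  else GenTree.Node 1 [::].
Fixpoint tree_decode (t : GenTree.tree binop) : option tree :=
  match t with
  | GenTree.Node 0 [:: GenTree.Leaf o; l; r] =>
      if (tree_decode l, tree_decode r) is (Some l', Some r')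
      then Some (Node o l' r') else None
  | _ => Some Leaf
  end.
Lemma tree_encodeK : pcancel tree_encode tree_decode.
Proof. by elim=> //= o l -> r ->. Qed.
HB.instance Definition _ := Countable.copy tree (pcan_type tree_encodeK).

Record wtree (w : nat) := WTree {wtree_val :> tree; _ : weight wtree_val == w}.
HB.instance Definition _ w := [isSub for @wtree_val w].
HB.instance Definition _ w := [Countable of wtree w by <:].

(** All trees of depth at most [d]; a tree of weight [w] has depth at most [w]. *)
Fixpoint trees_upto (d : nat) : seq tree :=
  if d is d'.+1 then
    let ts := trees_upto d' in
    Leaf :: [seq Node Vdash l r | l <- ts, r <- ts]
         ++ [seq Node Dashv l r | l <- ts, r <- ts]
  else [:: Leaf].

Lemma mem_trees_upto d t : (weight t <= d)%N -> t \in trees_upto d.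
Proof.
elim: d t => [|d IH] [|o l r] //=; rewrite ltnS => hw.
have hl : l \in trees_upto d by apply: IH; exact: leq_trans (leq_addr _ _) hw.
have hr : r \in trees_upto d by apply: IH; exact: leq_trans (leq_addl _ _) hw.
rewrite inE mem_cat; case: o => /=; apply/orP; [left|right].
  by apply/allpairsP; exists (l, r).
by apply/allpairsP; exists (l, r).
Qed.

Definition wtree_enum (w : nat) : seq (wtree w) :=
  pmap insub (undup (trees_upto w)).

Lemma wtree_enumP w : Finite.axiom (wtree_enum w).
Proof.
apply: Finite.uniq_enumP => [|t]; first exact/pmap_sub_uniq/undup_uniq.
rewrite mem_pmap_sub mem_undup; apply: mem_trees_upto.
by case: t => t /= /eqP ->.
Qed.
HB.instance Definition _ w := isFinite.Build (wtree w) (@wtree_enumP w).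

(** [graft t i s] plugs the root of [s] into the [i]-th leaf of [t] (leaves are
    numbered from 0, left to right). *)
Fixpoint graft (t : tree) (i : nat) (s : tree) : tree :=
  if t is Node o l r then
    if (i <= weight l)%N then Node o (graft l i s) r
    else Node o l (graft r (i - (weight l).+1) s)
  else s.

Lemma weight_graft t i s : weight (graft t i s) = (weight t + weight s)%N.
Proof.
elim: t i => [|o l IHl r IHr] i //=.
by case: ifP => _ /=; rewrite ?IHl ?IHr addSn ?addnA // addnAC.
Qed.

Lemma wgraft_subproof m n (t : wtree m) i (s : wtree n) :
  weight (graft t i s) == (m + n)%N.
Proof. by case: t s => t /= /eqP <- [s /= /eqP <-]; rewrite weight_graft. Qed.
Definition wgraft m n (t : wtree m) (i : 'I_m.+1) (s : wtree n) : wtree (m + n) :=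
  WTree (wgraft_subproof t i s).

(** The weight [w] (arity [w + 1]) component of the free operad. *)
Definition Op (F : realType) (w : nat) := {ffun wtree w -> F^o}.

Definition mono (F : realType) w (t : wtree w) : Op F w := [ffun u => (u == t)%:R].

Definition opcomp (F : realType) m n (x : Op F m) (i : 'I_m.+1) (y : Op F n) :
    Op F (m + n) :=
  \sum_(t : wtree m) \sum_(s : wtree n) (x t * y s) *: mono F (wgraft t i s).

Definition operad_ideal (F : realType) (I : forall w, set (Op F w)) : Prop :=
  [/\ forall w, I w 0,
      forall w (a : F) (x y : Op F w), I w x -> I w y -> I w (a *: x + y),
      forall m n (x : Op F m) (i : 'I_m.+1) (y : Op F n),
        I m x -> I (m + n)%N (opcomp x i y)
    & forall m n (x : Op F m) (i : 'I_m.+1) (y : Op F n),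
        I n y -> I (m + n)%N (opcomp x i y)].

Definition ideal_gen (F : realType) (R : set (Op F 2)) (w : nat) : set (Op F w) :=
  [set x | forall I : forall w', set (Op F w'),
             operad_ideal I -> R `<=` I 2%N -> I w x].
Arguments ideal_gen {F} R w _.

(** The weight [w] component of [O/I], as the set of cosets of [I w].  Its operad
    structure is induced from [O], so two quotients of [O] are the same operad as
    soon as they have the same components. *)
Definition quot (F : realType) (I : forall w, set (Op F w)) (w : nat) :
    set (set (Op F w)) :=
  [set [set y | I w (y - x)] | x in [set: Op F w]].
Arguments quot {F} I w _.

Definition mon_l (o1 o2 : binop) : wtree 2 :=   (* (- o1 -) o2 - *)
  @WTree 2 (Node o2 (Node o1 Leaf Leaf) Leaf) isT.
Definition mon_r (o1 o2 : binop) : wtree 2 :=   (* - o1 (- o2 -) *)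
  @WTree 2 (Node o1 Leaf (Node o2 Leaf Leaf)) isT.

Definition basis2 : 8.-tuple (wtree 2) :=
  [tuple mon_l Vdash Vdash; mon_l Vdash Dashv; mon_l Dashv Vdash; mon_l Dashv Dashv;
         mon_r Vdash Vdash; mon_r Vdash Dashv; mon_r Dashv Vdash; mon_r Dashv Dashv].

Definition of_coord (F : realType) (v : 'rV[F]_8) : Op F 2 :=
  \sum_(j < 8) v 0 j *: mono F (tnth basis2 j).

Definition bform (F : realType) (x y : Op F 2) : F :=
  \sum_(j < 8) (if (j < 4)%N then 1 else -1) *
               (x (tnth basis2 j) * y (tnth basis2 j)).

Definition orthcomp (F : realType) (R : set (Op F 2)) : set (Op F 2) :=
  [set x | forall y, R y -> bform x y = 0].

Definition presented (F : realType) (R : set (Op F 2)) :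
    forall w, set (set (Op F w)) := quot (ideal_gen R).
Arguments presented {F} R w _.

Definition koszul_dual (F : realType) (R : set (Op F 2)) :
    forall w, set (set (Op F w)) := presented (orthcomp R).
Arguments koszul_dual {F} R w _.

Definition self_dual (F : realType) (R : set (Op F 2)) : Prop :=
  forall w, presented R w = koszul_dual R w.

Definition row_space (F : realType) (M : 'M[F]_(4, 8)) : set (Op F 2) :=
  [set of_coord v | v in [set v : 'rV[F]_8 | (v <= M)%MS]].

(** [M] has full row rank, is in row canonical form, and the leading 1 of row [i]
    is in column [tnth J i]. *)
Definition rcf (F : realType) m n (J : m.-tuple 'I_n) (M : 'M[F]_(m, n)) : Prop :=
  [/\ forall i k : 'I_m, (i < k)%N -> (tnth J i < tnth J k)%N,
      forall i : 'I_m, M i (tnth J i) = 1,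
      forall i k : 'I_m, k != i -> M k (tnth J i) = 0
    & forall (i : 'I_m) (j : 'I_n), (j < tnth J i)%N -> M i j = 0].

(** The [k]-th column outside [J], in increasing order; the default value of
    [nth] is irrelevant because [J] has four distinct entries. *)
Definition free_col (J : 4.-tuple 'I_8) (k : 'I_4) : 'I_8 :=
  nth ord0 (enum [predC J]) k.

Definition param_mx (F : realType) (J : 4.-tuple 'I_8) (M : 'M[F]_(4, 8)) :
    'M[F]_4 := colsub (free_col J) M.

(** Entry [(i, k)] of the parameter matrix comes from a position to the left of
    the leading 1 of row [i]. *)
Definition forced_zero (J : 4.-tuple 'I_8) (i k : 'I_4) : bool :=
  (free_col J k < tnth J i)%N.

(** Columns numbered from 1. *)
Local Notation "# c" := (@Ordinal 8 c.-1 isT) (at level 0, c at level 0).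

Definition case_table : seq (nat * 4.-tuple 'I_8) :=
  [:: ( 1, [tuple #1; #2; #3; #4]);
      ( 2, [tuple #1; #2; #3; #5]);
      ( 3, [tuple #1; #2; #3; #6]);
      ( 4, [tuple #1; #2; #3; #7]);
      ( 6, [tuple #1; #2; #4; #5]);
      ( 7, [tuple #1; #2; #4; #6]);
      ( 8, [tuple #1; #2; #4; #7]);
      (10, [tuple #1; #2; #5; #6]);
      (11, [tuple #1; #2; #5; #7]);
      (16, [tuple #1; #3; #4; #5]);
      (17, [tuple #1; #3; #4; #6]);
      (18, [tuple #1; #3; #4; #7]);
      (20, [tuple #1; #3; #5; #6]);
      (21, [tuple #1; #3; #5; #7])]%N.

(** The case number is the position of the pivot set in the lexicographic list
    of the four-element subsets of [{1, ..., 8}] containing 1. *)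
Definition lex_pivots : seq (seq nat) :=
  [seq 1%N :: s | s <- [seq [:: a; bc.1; bc.2] | a <- iota 2 7,
     bc <- [seq (b, c) | b <- iota a.+1 (8 - a), c <- iota b.+1 (8 - b)]]].
Fact case_tableE :
  size lex_pivots = 35%N /\
  all (fun kJ : nat * 4.-tuple 'I_8 =>
         nth [::] lex_pivots kJ.1.-1 == [seq (val j).+1 | j <- kJ.2])
      case_table.
Proof. by split; vm_compute. Qed.

Definition diag4 (F : realType) (a b c d : F) : 'M[F]_4 :=
  diag_mx (\row_(i < 4) nth 0 [:: a; b; c; d] i).

Definition Dmx (F : realType) (k : nat) : 'M[F]_4 :=
  if k == 1%N then 1%:M
  else if k \in [:: 2; 3; 4; 6; 7; 8; 16; 17; 18]%N then diag4 1 1 1 (-1)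
  else diag4 1 1 (-1) (-1).

Definition Emx (F : realType) (k : nat) : 'M[F]_4 :=
  if k == 1%N then 1%:M
  else if k \in [:: 2; 3; 4; 6; 7; 8; 16; 17; 18]%N then diag4 (-1) 1 1 1
  else diag4 (-1) (-1) 1 1.

Definition to_complex (F : realType) m n (A : 'M[F]_(m, n)) : 'M[F[i]]_(m, n) :=
  map_mx (real_complex F) A.

Definition conj_mx (F : realType) m n (A : 'M[F[i]]_(m, n)) : 'M[F[i]]_(m, n) :=
  map_mx Num.conj A.

(** [S] is one of the possible square roots: each diagonal entry -1 of [D] may
    contribute either ['i] or [- 'i]. *)
Definition is_diag_sqrt (F : realType) n (D : 'M[F]_n) (S : 'M[F[i]]_n) : Prop :=
  [/\ is_diag_mx S, S *m S = to_complex D & forall i, D i i = 1 -> S i i = 1].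

(* Main.v *)
(** Let [G] be the Gram matrix of the form.  The weight-2 component of the ideal
    generated by a subspace [R] of O(2) is [R] itself, so self-duality means
    [R = R^±], and for the row space of a rank 4 matrix [M] this is
    [M G M^t = 0].  In row canonical form the pivot columns of [M] form the
    identity and the others form [P], so this equation reads [D - P E P^t = 0]
    where [D] and [-E] are the blocks of [G] on the pivot and the free columns.
    Since [D^2 = E^2 = 1], it is equivalent to [P^t D P = E]. *)
Require Import Defs.
From HB Require Import structures.
From mathcomp Require Import all_boot all_order all_algebra.
From mathcomp Require Import boolp classical_sets reals.
From mathcomp Require Import complex.
Set Implicit Arguments.
Unset Strict Implicit.
Unset Printing Implicit Defensive.
Import Order.TTheory GRing.Theory Num.Theory.
Local Open Scope classical_set_scope.
Local Open Scope ring_scope.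

(** * Ideals of the free operad in weight 2 *)

Lemma graft_Leaf t i : graft t i Leaf = t.
Proof. by elim: t i => //= o l IHl r IHr i; rewrite IHl IHr if_same. Qed.

Section Ideal.
Variable F : realType.

Definition linear_set w (R : set (Op F w)) : Prop :=
  R 0 /\ forall (a : F) x y, R x -> R y -> R (a *: x + y).

Lemma linear_setZ w (R : set (Op F w)) a x : linear_set R -> R x -> R (a *: x).
Proof. by move=> [R0 RD] Rx; rewrite -[_ *: _]addr0; apply: RD. Qed.

Lemma opcomp0l m n (i : 'I_m.+1) (y : Op F n) : opcomp (0 : Op F m) i y = 0.
Proof.
by rewrite /opcomp big1 // => t _; rewrite big1 // => s _; rewrite ffunE mul0r scale0r.
Qed.

Lemma opcomp0r m n (x : Op F m) (i : 'I_m.+1) : opcomp x i (0 : Op F n) = 0.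
Proof.
by rewrite /opcomp big1 // => t _; rewrite big1 // => s _; rewrite ffunE mulr0 scale0r.
Qed.

Definition leaf : wtree 0 := @WTree 0 Leaf isT.

Lemma wtree0E (t : wtree 0) : t = leaf.
Proof. by apply: val_inj; case: t => -[]. Qed.

Lemma Op_mono w (x : Op F w) : x = \sum_t x t *: mono F t.
Proof.
apply/ffunP => u; rewrite sum_ffunE (bigD1 u) //= big1 => [|t tu].
  by rewrite addr0 !ffunE eqxx [_ *: _]mulr1.
by rewrite !ffunE eq_sym (negPf tu) [_ *: _]mulr0.
Qed.

Lemma sum_wtree0 (V : nmodType) (f : wtree 0 -> V) : \sum_t f t = f leaf.
Proof.
by rewrite (bigD1 leaf) //= big1 ?addr0 // => t; rewrite (wtree0E t) eqxx.
Qed.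

(** The bare leaf is the only tree of weight 0 and is the unit of grafting, so composing with weight
    0 is a scaling. These are the only compositions that keep an element of weight 2 in weight 2. *)
Lemma opcomp_unitr (x : Op F 2) (i : 'I_3) (y : Op F 0) :
  opcomp x i y = y leaf *: x.
Proof.
rewrite /opcomp [in RHS](Op_mono x) scaler_sumr; apply: eq_bigr => t _.
rewrite sum_wtree0 scalerA mulrC; congr (_ *: mono F _); apply: val_inj => /=.
exact: graft_Leaf.
Qed.

Lemma opcomp_unitl (x : Op F 0) (i : 'I_1) (y : Op F 2) :
  opcomp x i y = x leaf *: y.
Proof.
rewrite /opcomp sum_wtree0 [in RHS](Op_mono y) scaler_sumr.
apply: eq_bigr => t _; rewrite scalerA; congr (_ *: mono F _).
exact: val_inj.
Qed.

(** Test ideal bounding the generated one from above: it meets weight 2 in exactly [R]. Closure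
    holds because grafting adds weights. *)
Definition truncated_ideal (R : set (Op F 2)) (w : nat) : set (Op F w) :=
  match w with
  | 0%N | 1%N => [set 0]
  | 2%N => R
  | _ => setT
  end.

Lemma truncated_ideal_operad (R : set (Op F 2)) :
  linear_set R -> operad_ideal (truncated_ideal R).
Proof.
move=> linR; have [R0 RD] := linR; split.
- by case=> [|[|[|w]]].
- case=> [|[|[|w]]] a x y //=; last exact: RD.
  + by move=> -> ->; rewrite scaler0 addr0.
  + by move=> -> ->; rewrite scaler0 addr0.
(* Total weight at least 3 is trivial and a factor in weight 0 or 1 vanishes; what remains is weight
   2 composed with weight 0. *)
- case=> [|[|[|m]]] [|[|[|n]]] //= x i y Ix; rewrite ?Ix ?opcomp0l //.
  by rewrite opcomp_unitr; exact: linear_setZ.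
- case=> [|[|[|m]]] [|[|[|n]]] //= x i y Iy; rewrite ?Iy ?opcomp0r //.
  by rewrite opcomp_unitl; exact: linear_setZ.
Qed.

Lemma ideal_gen2 (R : set (Op F 2)) : linear_set R -> ideal_gen R 2 = R.
Proof.
move=> linR; apply/seteqP; split=> x /=; last by move=> Rx I _; apply.
by move=> /(_ _ (truncated_ideal_operad linR)); exact.
Qed.

Lemma linear_orthcomp (R : set (Op F 2)) : linear_set (orthcomp R).
Proof.
split=> [y _|a x1 x2 R1 R2 y Ry].
  by rewrite /bform big1 // => j _; rewrite ffunE mul0r mulr0.
have -> : bform (a *: x1 + x2) y = a * bform x1 y + bform x2 y.
  rewrite /bform mulr_sumr -big_split; apply: eq_bigr => j _ /=.
  by rewrite !ffunE mulrDl mulrDr [_ *: _]/(_ * _) !mulrA (mulrC a).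
by rewrite (R1 y Ry) (R2 y Ry) mulr0 addr0.
Qed.

(** Equal quotients have the same cosets in weight 2, and a subspace is recovered from its cosets as
    the one containing 0. *)
Lemma self_dualP (R : set (Op F 2)) :
  linear_set R -> self_dual R <-> R = orthcomp R.
Proof.
move=> linR; split=> [sd|RE w]; last by rewrite /koszul_dual -RE.
have [R0 _] := linR; have linR' := linear_orthcomp R.
have := sd 2%N; rewrite /koszul_dual /presented /quot !ideal_gen2 // => quotE.
have : [set [set y | R (y - x)] | x in [set: Op F 2]] R.
  by exists 0 => //; apply/seteqP; split=> y /=; rewrite subr0.
(* Now [R] is a coset of some [x] modulo [orthcomp R]; as it contains 0, [x] lies in
   [orthcomp R]. *)
rewrite quotE => -[x _ RE].
have R'x : orthcomp R x.
  have : R 0 by []; rewrite -{1}RE /= sub0r => R'Nx.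
  by rewrite -[x]opprK -scaleN1r; exact: linear_setZ linR' R'Nx.
rewrite -{1}RE; apply/seteqP; split=> y /= R'y.
  by have := linR'.2 1 _ _ R'x R'y; rewrite scale1r addrC subrK.
by have := linR'.2 (-1) _ _ R'x R'y; rewrite scaleN1r addrC.
Qed.

End Ideal.

(** * Coordinates and the Gram matrix *)

Section Coordinates.
Variable F : realType.

Lemma basis2_surj (t : wtree 2) : exists j, tnth basis2 j = t.
Proof.
suff /tnthP[j ->] : t \in basis2 by exists j.
(* On underlying trees a case analysis suffices: the weight equation leaves one child of the root a
   leaf and the other a single node. *)
have : wtree_val t \in map (@wtree_val 2) basis2.
  case: t => t /=; case: t => [|o l r] //=.
  case: l => [|o1 [|? ? ?] [|? ? ?]] /=; case: r => [|o2 [|? ? ?] [|? ? ?]] //=;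
    rewrite ?addnS ?addSn ?addn0 //.
    by case: o o2 => [] [].
  by case: o o1 => [] [].
by rewrite (mem_map val_inj).
Qed.

Lemma tnth_basis2_inj : injective (tnth basis2).
Proof. by apply/tuple_uniqP. Qed.

Lemma of_coordE (v : 'rV[F]_8) j : of_coord v (tnth basis2 j) = v 0 j.
Proof.
rewrite /of_coord sum_ffunE (bigD1 j) //= big1 => [|l lj].
  by rewrite addr0 !ffunE eqxx [_ *: _]mulr1.
by rewrite !ffunE (inj_eq tnth_basis2_inj) eq_sym (negPf lj) [_ *: _]mulr0.
Qed.

Definition coord2 (x : Op F 2) : 'rV[F]_8 := \row_j x (tnth basis2 j).

Lemma of_coordK : cancel (@of_coord F) coord2.
Proof. by move=> v; apply/rowP => j; rewrite mxE of_coordE. Qed.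

Lemma coord2K : cancel coord2 (@of_coord F).
Proof.
by move=> x; apply/ffunP => t; have [j <-] := basis2_surj t; rewrite of_coordE mxE.
Qed.

Definition bsign (j : 'I_8) : F := if (j < 4)%N then 1 else -1.

(** Stated for any choice of columns, so as to cover the Gram matrix and its blocks on the pivot and
    free columns. *)
Lemma diag_sign_sqr n (f : 'I_n -> 'I_8) :
  diag_mx (\row_i bsign (f i)) *m diag_mx (\row_i bsign (f i)) = 1%:M.
Proof.
apply/matrixP => i j; rewrite mul_diag_mx !mxE /bsign mulrnAr.
by case: ifP => _; rewrite ?mulrNN mulr1.
Qed.

Definition gram2 : 'M[F]_8 := diag_mx (\row_j bsign j).

Lemma bform_coord (x y : Op F 2) :
  bform x y = (coord2 x *m gram2 *m (coord2 y)^T) 0 0.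
Proof.
rewrite mul_mx_diag !mxE; apply: eq_bigr => j _.
by rewrite !mxE mulrA (mulrC (x _)).
Qed.

Lemma row_spaceE (M : 'M[F]_(4, 8)) x : row_space M x <-> (coord2 x <= M)%MS.
Proof.
split=> [[v vM <-]|xM]; first by rewrite of_coordK.
by exists (coord2 x) => //; rewrite coord2K.
Qed.

Lemma linear_row_space (M : 'M[F]_(4, 8)) : linear_set (row_space M).
Proof.
have coordD a x y : coord2 (a *: x + y) = a *: coord2 x + coord2 y.
  by apply/rowP => j; rewrite !mxE !ffunE.
split=> [|a x y /row_spaceE xM /row_spaceE yM]; apply/row_spaceE.
  suff -> : coord2 0 = 0 by exact: sub0mx.
  by apply/rowP => j; rewrite !mxE !ffunE.
by rewrite coordD addmx_sub // scalemx_sub.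
Qed.

Lemma orthcomp_row_space (M : 'M[F]_(4, 8)) x :
  orthcomp (row_space M) x <-> (coord2 x <= kermx (gram2 *m M^T))%MS.
Proof.
split=> [xM|/sub_kermxP xM y /row_spaceE/submxP[u yE]]; last first.
  by rewrite bform_coord yE trmx_mul mulmxA -(mulmxA _ gram2) xM mul0mx mxE.
apply/sub_kermxP/rowP => i.
(* Pairing with row [i] of [M] gives the [i]-th coordinate of the product. *)
have /xM : row_space M (of_coord (row i M)).
  by apply/row_spaceE; rewrite of_coordK row_sub.
rewrite bform_coord of_coordK tr_row colE !mulmxA -colE mxE => ->.
by rewrite mxE.
Qed.

(** The equation says that [R] is contained in its complement. Since the Gram matrix is invertible,
    the complement has dimension 8 - 4 = 4, so the inclusion is an equality. *)
Lemma orthcomp_fixedP (M : 'M[F]_(4, 8)) : row_free M ->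
  row_space M = orthcomp (row_space M) <-> M *m gram2 *m M^T = 0.
Proof.
move=> freeM; rewrite -mulmxA; split=> [RE|MG0].
  apply/sub_kermxP/row_subP => i; rewrite -[row i M]of_coordK.
  apply/orthcomp_row_space; rewrite -RE; apply/row_spaceE.
  by rewrite of_coordK row_sub.
have [G_unit _] := mulmx1_unit (diag_sign_sqr id).
have eqM : (M == kermx (gram2 *m M^T))%MS.
  rewrite -(geq_leqif (mxrank_leqif_eq _)); last exact/sub_kermxP.
  rewrite mxrank_ker -mxrank_tr trmx_mul trmxK tr_diag_mx.
  by rewrite mxrankMfree ?row_free_unit // (eqP freeM).
apply/seteqP; split=> x.
  by move=> /row_spaceE xM; apply/orthcomp_row_space; rewrite -(eqmxP eqM).
by move=> /orthcomp_row_space xM; apply/row_spaceE; rewrite (eqmxP eqM).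
Qed.

End Coordinates.

(** * Pivot and free columns *)

Section RowCanonicalForm.
Variables (F : realType) (J : 4.-tuple 'I_8) (M : 'M[F]_(4, 8)).
Hypothesis hM : rcf J M.

Let P := param_mx J M.

Lemma rcf_uniq : uniq J.
Proof.
have [incJ _ _ _] := hM; apply/tuple_uniqP => i k /(congr1 val) /= eqJ.
apply/val_inj/eqP; rewrite /= eqn_leq leqNgt [(k <= i)%N]leqNgt.
by apply/andP; split; apply/negP => /incJ; rewrite eqJ ltnn.
Qed.

Lemma rcf_pivot i k : M k (tnth J i) = (k == i)%:R.
Proof.
have [_ M1 M0 _] := hM.
by case: (eqVneq k i) => [->|/M0 ->].
Qed.

Lemma rcf_row_free : row_free M.
Proof.
(* The right inverse selects the pivot columns, where [M] is the identity. *)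
apply/row_freeP; exists (\matrix_(j, i) (j == tnth J i)%:R).
apply/matrixP => i k; rewrite !mxE (bigD1 (tnth J k)) //= big1 => [|j jk].
  by rewrite mxE eqxx mulr1 addr0 rcf_pivot.
by rewrite mxE (negPf jk) mulr0.
Qed.

Lemma param_mx_forced_zero i k : forced_zero J i k -> P i k = 0.
Proof. by have [_ _ _ M0] := hM; rewrite mxE; exact: M0. Qed.

Lemma sum_pivot_free (f : 'I_8 -> F) :
  \sum_j f j = \sum_i f (tnth J i) + \sum_k f (free_col J k).
Proof.
rewrite (bigID (mem J)) /= -big_uniq ?rcf_uniq // big_tuple; congr (_ + _).
(* There are exactly 8 - 4 free columns, so [free_col] never reaches the default of [nth]. *)
have size4 : size (enum [predC J]) = 4.
  rewrite -cardE; have := cardC (mem J).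
  by rewrite (card_uniqP rcf_uniq) size_tuple card_ord => -[].
transitivity (\sum_(j <- enum [predC J]) f j); first by rewrite big_enum.
by rewrite [LHS](big_nth ord0) size4 big_mkord.
Qed.

Lemma gram_row_space :
  M *m gram2 F *m M^T =
  diag_mx (\row_i bsign F (tnth J i)) +
  P *m diag_mx (\row_k bsign F (free_col J k)) *m P^T.
Proof.
apply/matrixP => i l; rewrite !mul_mx_diag [LHS]mxE sum_pivot_free.
rewrite [RHS]mxE; congr (_ + _); last first.
  by rewrite [RHS]mxE; apply: eq_bigr => k _; rewrite !mxE.
rewrite (bigD1 i) //= big1 => [|k ki]; rewrite !mxE !rcf_pivot.
  by rewrite eqxx mul1r addr0 mulr_natr eq_sym.
by rewrite eq_sym (negPf ki) !mul0r.
Qed.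

End RowCanonicalForm.

(** * The signs in the fourteen cases *)

Section CaseTable.
Variable F : realType.

(** The filtered list of numbers evaluates on an explicit [J], which the case check relies on. The
    defaults [ord0] and 0 agree past the end. *)
Lemma free_col_val J k : free_col J k =
  nth 0%N [seq j <- iota 0 8 | j \notin map val J] k :> nat.
Proof.
rewrite -val_enum_ord filter_map.
have -> : [seq j <- enum 'I_8 | preim val (fun j => j \notin map val J) j] =
          enum [predC J].
  rewrite [RHS]/enum_mem -enumT.
  by apply: eq_filter => j /=; rewrite (mem_map val_inj) !inE.
have [kle|kge] := ltnP k (size (enum [predC J])); first by rewrite (nth_map ord0).
by rewrite /free_col !nth_default ?size_map.
Qed.

Lemma case_table_DE k J : (k, J) \in case_table ->
  Dmx F k = diag_mx (\row_i bsign F (tnth J i)) /\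
  Emx F k = - diag_mx (\row_l bsign F (free_col J l)).
Proof.
have diagP (a b c d : F) (v : 'rV[F]_4) :
    (forall i : 'I_4, nth 0 [:: a; b; c; d] i = v 0 i) -> diag4 a b c d = diag_mx v.
  by move=> abcdv; congr diag_mx; apply/rowP => i; rewrite mxE.
have diag1 : 1%:M = diag4 1 1 1 1 :> 'M[F]_4.
  rewrite -diag_const_mx; apply/esym/diagP.
  by case=> [[|[|[|[|//]]]]] ?; rewrite mxE.
rewrite -raddfN => Jin; rewrite /Dmx /Emx diag1; move: Jin.
rewrite !inE.
(* One goal per row of the table, each settled by evaluating four signs on either side. *)
do 13?[case/orP]; rewrite xpair_eqE => /andP[/eqP -> /eqP ->] /=.
all: split; apply: diagP; case=> [[|[|[|[|//]]]]] ?.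
all: by rewrite !mxE /bsign ?free_col_val ?(tnth_nth ord0) /= ?opprK.
Qed.

End CaseTable.

(** * Inverting the congruence *)

(** From [A E A^t = D] follows [(A E)(A^t D) = 1]. Square factors commute in such a product, so
    [A^t D A E = 1], and multiplying by [E] gives the claim. The converse is the same argument for
    [A^t]. *)
Lemma congruence_inv (R : comUnitRingType) n (A D E : 'M[R]_n) :
  D *m D = 1%:M -> E *m E = 1%:M ->
  A *m E *m A^T = D <-> A^T *m D *m A = E.
Proof.
have half (B D' E' : 'M[R]_n) : D' *m D' = 1%:M -> E' *m E' = 1%:M ->
    B *m E' *m B^T = D' -> B^T *m D' *m B = E'.
  move=> DD EE BE; have : B *m E' *m (B^T *m D') = 1%:M by rewrite mulmxA BE.
  move/mulmx1C; rewrite mulmxA => /(congr1 (mulmx^~ E')).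
  by rewrite -(mulmxA _ E') EE mulmx1 mul1mx.
move=> DD EE; split=> [|AD]; first exact: half.
by rewrite -{1}[A]trmxK; apply: half; rewrite ?trmxK.
Qed.

(** * The orthogonal form over the complex numbers *)

Section ComplexForm.
Variable F : realType.

Lemma diag_sqrt_diag n (D : 'M[F]_n) S : is_diag_sqrt D S -> exists s, S = diag_mx s.
Proof. by case=> /diag_mxP. Qed.

(** Each diagonal entry of [S] has fourth power 1, hence modulus 1, so its conjugate is its
    inverse. *)
Lemma conj_diag_sqrt n (D : 'M[F]_n) S :
  D *m D = 1%:M -> is_diag_sqrt D S -> conj_mx S *m S = 1%:M.
Proof.
move=> DD hS; have [_ SS _] := hS; have [s sE] := diag_sqrt_diag hS.
have SSSS : S *m S *m (S *m S) = 1%:M.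
  by rewrite SS /to_complex -map_mxM DD map_mx1.
rewrite sE /conj_mx map_diag_mx mulmx_diag -diag_const_mx; congr diag_mx.
apply/rowP => i; rewrite !mxE mulrC -normCK.
move/matrixP/(_ i i): SSSS; rewrite sE !mulmx_diag !mxE eqxx !mulr1n -!expr2 -exprM.
move/(congr1 Num.norm); rewrite normrX normr1 => /eqP.
by rewrite pexpr_eq1 // => /eqP ->; rewrite expr1n.
Qed.

(** [C] comes from solving the factorization of [P] for its middle factor. Then [C^t C] reduces to
    the conjugate of [sqrtE] on both sides of [E], which is 1. *)
Lemma complex_orthogonal_form (P D E : 'M[F]_4) sqrtD sqrtE :
  D *m D = 1%:M -> E *m E = 1%:M -> P^T *m D *m P = E ->
  is_diag_sqrt D sqrtD -> is_diag_sqrt E sqrtE ->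
  let C := sqrtD *m to_complex P *m conj_mx sqrtE in
  [/\ C^T *m C = 1%:M, forall i j, P i j = 0 -> C i j = 0
    & to_complex P = conj_mx sqrtD *m C *m sqrtE].
Proof.
move=> DD EE PDP hD hE C.
have cD := conj_diag_sqrt DD hD; have cE := conj_diag_sqrt EE hE.
have [d dE] := diag_sqrt_diag hD; have [e eE] := diag_sqrt_diag hE.
have [_ sD _] := hD; have [_ sE _] := hE.
have tD : sqrtD^T = sqrtD by rewrite dE tr_diag_mx.
have tE : (conj_mx sqrtE)^T = conj_mx sqrtE.
  by rewrite eE /conj_mx map_diag_mx tr_diag_mx.
have PDPc : (to_complex P)^T *m (sqrtD *m sqrtD) *m to_complex P = sqrtE *m sqrtE.
  by rewrite sD sE -PDP /to_complex !map_mxM map_trmx.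
split.
- rewrite /C !trmx_mul tD tE !mulmxA.
  rewrite -(mulmxA _ sqrtD sqrtD) -(mulmxA (conj_mx _)) -(mulmxA (conj_mx _)) PDPc.
  by rewrite !mulmxA cE mul1mx; apply: mulmx1C.
(* Diagonal factors only rescale entries, so zeros persist. *)
- move=> i j Pij; rewrite /C dE eE /conj_mx map_diag_mx mul_diag_mx mul_mx_diag.
  by rewrite !mxE Pij rmorph0 mulr0 mul0r.
- by rewrite /C !mulmxA cD mul1mx -mulmxA cE mulmx1.
Qed.

End ComplexForm.

Theorem theorem3p11 (F : realType) (k : nat) (J : 4.-tuple 'I_8)
    (M : 'M[F]_(4, 8)) (hJ : (k, J) \in case_table) (hM : rcf J M) :
  (self_dual (row_space M) <->
     (param_mx J M)^T *m Dmx F k *m param_mx J M = Emx F k)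
  /\
  ((param_mx J M)^T *m Dmx F k *m param_mx J M = Emx F k ->
   forall sqrtD sqrtE : 'M[F[i]]_4,
     is_diag_sqrt (Dmx F k) sqrtD -> is_diag_sqrt (Emx F k) sqrtE ->
     exists C : 'M[F[i]]_4,
       [/\ C^T *m C = 1%:M,
           forall i j : 'I_4, forced_zero J i j -> C i j = 0
         & to_complex (param_mx J M) = conj_mx sqrtD *m C *m sqrtE]).
Proof.
have [DE EE] := case_table_DE F hJ.
have DD : Dmx F k *m Dmx F k = 1%:M by rewrite DE diag_sign_sqr.
have EE1 : Emx F k *m Emx F k = 1%:M by rewrite EE mulmxN mulNmx opprK diag_sign_sqr.
split; last first.
  move=> PDP sqrtD sqrtE hD hE.
  have [CC C0 PE] := complex_orthogonal_form DD EE1 PDP hD hE.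
  exists (sqrtD *m to_complex (param_mx J M) *m conj_mx sqrtE); split=> // i j ij.
  by apply: C0; exact: param_mx_forced_zero.
rewrite -(congruence_inv _ DD EE1).
rewrite (self_dualP (linear_row_space M)) (orthcomp_fixedP (rcf_row_free hM)).
(* The sign block on the free columns is [-E], which turns the sum into [D - P E P^t]. *)
rewrite (gram_row_space hM) -DE -[diag_mx _]opprK -EE mulmxN mulNmx.
by split=> [/eqP|->]; rewrite ?subrr // subr_eq0 => /eqP.
Qed.
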